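(* Let $M\ge N\ge1$ and $D\ge1$ be integers and let $\mathcal R=\mathbb R[t]/(t^D)$. Let $A,Q\in\mathcal R^{M\times N}$ and $R\in\mathcal R^{N\times N}$ with $R$ invertible satisfy the QR system $$A=QR,\qquad Q^TQ=I,\qquad P_L\circ R=0 .$$ Let $\bar Q\in\mathcal R^{M\times N}$ and $\bar R\in\mathcal R^{N\times N}$ be arbitrary and define $$\bar A:=Q\Big(\bar R+\big(P_L\circ\big(R\bar R^T-\bar RR^T+Q^T\bar Q-\bar Q^TQ\big)\big)R^{-T}\Big)+\big(\bar Q-QQ^T\bar Q\big)R^{-T}.$$ Then for all differentials $\mathrm dA,\mathrm dQ\in\mathcal R^{M\times N}$, $\mathrm dR\in\mathcal R^{N\times N}$ satisfying the differentiated QR system $$\mathrm dA=\mathrm dQ\,R+Q\,\mathrm dR,\qquad \mathrm dQ^TQ+Q^T\mathrm dQ=0,\qquad P_L\circ \mathrm dR=0,$$ one has $$\operatorname{tr}(\bar A^T\mathrm dA)=\operatorname{tr}(\bar Q^T\mathrm dQ)+\operatorname{tr}(\bar R^T\mathrm dR)\quad\text{in }\mathcal R .$$ Moreover, if $M=N$, the last term $(\bar Q-QQ^T\bar Q)R^{-T}$ vanishes.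
   Context: Matrices over $\mathcal R=\mathbb R[t]/(t^D)$ are identified with polynomials $\sum_{d=0}^{D-1}X_dt^d$ with real matrix coefficients, multiplied modulo $t^D$. The case $D=1$ is the ordinary real case. $\circ$ is the Hadamard (entrywise) product. $P_L\in\mathbb R^{N\times N}$ has $(P_L)_{ij}=1$ if $i>j$ and $0$ otherwise, so $P_L\circ R=0$ means $R$ is upper triangular. $I$ is the identity matrix and $R^{-T}=(R^{-1})^T$. The pullback of the QR decomposition $A\mapsto(Q,R)$ is the map computing the adjoint $\bar A$ of the input from the adjoints $\bar Q,\bar R$ of the outputs so that the trace identity $\operatorname{tr}(\bar A^T\mathrm dA)=\operatorname{tr}(\bar Q^T\mathrm dQ)+\operatorname{tr}(\bar R^T\mathrm dR)$ holds for all differentials $\mathrm dA,\mathrm dQ,\mathrm dR$ satisfying the differentiated QR system $\mathrm dA=\mathrm dQ\,R+Q\,\mathrm dR$, $\mathrm dQ^TQ+Q^T\mathrm dQ=0$, $P_L\circ\mathrm dR=0$. *)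

(* Defs.v *)
From HB Require Import structures.
From mathcomp Require Import all_boot all_order all_algebra.
From mathcomp Require Import reals.

Set Implicit Arguments.
Unset Strict Implicit.
Unset Printing Implicit Defensive.

Import GRing.Theory.
Local Open Scope ring_scope.

(* The ring K[t]/(t^D). Pitfall: {poly %/ h} silently becomes {poly %/ 'X}    *)
(* when h is constant, so this is the intended ring only for 0 < D.           *)
Notation trunc_poly K D := {poly %/ ('X^D : {poly K})}.

Definition hadamard (S : pzSemiRingType) (m n : nat) (X Y : 'M[S]_(m, n)) :
  'M[S]_(m, n) := \matrix_(i, j) (X i j * Y i j).

(* The 0/1 matrix P_L is taken directly over the ring S in which it is used;  *)
(* for S = K[t]/(t^D) it is the constant polynomial matrix of the real P_L.   *)
Definition P_L (S : pzSemiRingType) (n : nat) : 'M[S]_n :=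
  \matrix_(i, j) (j < i)%N%:R.

Definition qr_system (S : comUnitRingType) (M N : nat)
    (A Q : 'M[S]_(M, N)) (R : 'M[S]_N) : Prop :=
  [/\ A = Q *m R, Q^T *m Q = 1%:M & hadamard (P_L S N) R = 0].

Definition diff_qr_system (S : comUnitRingType) (M N : nat)
    (Q : 'M[S]_(M, N)) (R : 'M[S]_N) (dA dQ : 'M[S]_(M, N)) (dR : 'M[S]_N) :
    Prop :=
  [/\ dA = dQ *m R + Q *m dR,
      dQ^T *m Q + Q^T *m dQ = 0 &
      hadamard (P_L S N) dR = 0].

Definition qr_pullback (S : comUnitRingType) (M N : nat)
    (Q : 'M[S]_(M, N)) (R : 'M[S]_N) (Qbar : 'M[S]_(M, N)) (Rbar : 'M[S]_N) :
    'M[S]_(M, N) :=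
  Q *m (Rbar + hadamard (P_L S N)
                 (R *m Rbar^T - Rbar *m R^T + Q^T *m Qbar - Qbar^T *m Q)
               *m (invmx R)^T)
  + (Qbar - Q *m Q^T *m Qbar) *m (invmx R)^T.

(* Main.v *)
(* Write W = Q^T dQ, which is skew, and U = dR R^-1, which is upper            *)
(* triangular. Expanding the trace, the identity reduces to                    *)
(* tr (L W) = tr (Y W) and tr (L^T U) = 0, where L is the strictly lower part  *)
(* of Y - Y^T and Y = R Rbar^T - Qbar^T Q. The second holds since L^T U has    *)
(* zero diagonal; the first because L - L^T = Y - Y^T and W is skew, so that   *)
(* both sides have the same double.                                            *)

Require Import Defs.
From HB Require Import structures.
From mathcomp Require Import all_boot all_order all_algebra.
From mathcomp Require Import reals.

Set Implicit Arguments.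
Unset Strict Implicit.
Unset Printing Implicit Defensive.

Import GRing.Theory.
Local Open Scope ring_scope.

(** Split [dQ] by its pairing with [Q] and with the residual [H = Qbar - Q Q^T Qbar], which
    satisfies [H^T Q = 0]. The [H] part of the trace gives [tr (Qbar^T dQ) - tr (Qbar^T Q W)]; the
    rest gives [tr (Rbar^T dR)], a term killed by [mxtrace_PL_upper], and
    [tr (R Rbar^T W) - tr (L W)]. By [mxtrace_PL_skew] the terms in [W] cancel. The argument works
    over any commutative ring where doubling is injective ([qr_pullback_trace]). *)

Lemma hadamard_PL_eq0 (S : pzSemiRingType) (n : nat) (X : 'M[S]_n) :
  hadamard (P_L S n) X = 0 <-> is_trig_mx X^T.
Proof.
split=> [/matrixP X0 | /is_trig_mxP X0].
  by apply/is_trig_mxP => i j ij; have := X0 j i; rewrite !mxE ij mul1r.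
apply/matrixP => i j; rewrite !mxE; case: ltnP => [ij | _]; last exact: mul0r.
by have := X0 j i ij; rewrite mxE mul1r.
Qed.

Lemma trig_unitmx_diag (S : comUnitRingType) (n : nat) (T : 'M[S]_n) :
  is_trig_mx T -> T \in unitmx -> forall i, T i i \is a GRing.unit.
Proof.
move=> trT; rewrite unitmxE det_trig // => /unitr_prodP uT i.
by apply: uT => //; rewrite mem_index_enum.
Qed.

(** Forward substitution, by strong induction on the row: above the diagonal, entry [(i, j)] of
    [T *m V] reduces to [T i i * V i j], and [T i i] is a unit. This yields triangularity of [U]
    without that of [invmx R]. *)
Lemma trig_mulmx_cancel (S : comUnitRingType) (n : nat) (T V : 'M[S]_n) :
  is_trig_mx T -> T \in unitmx -> is_trig_mx (T *m V) -> is_trig_mx V.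
Proof.
move=> trT uT /is_trig_mxP trTV; apply/is_trig_mxP => i j.
have [m] := ubnP (i : nat); elim: m i => // m IHm i /ltnSE im ij.
have := trTV i j ij; rewrite mxE (bigD1 i) //= big1 => [|k ki].
  rewrite addr0 => TV0.
  by apply: (mulrI (trig_unitmx_diag trT uT i)); rewrite mulr0.
have [ik | ki_lt | /val_inj ik] := ltngtP i k.
- by rewrite (is_trig_mxP trT) ?mul0r.
- by rewrite IHm ?mulr0 // ?(leq_trans ki_lt im) ?(ltn_trans ki_lt ij).
- by rewrite ik eqxx in ki.
Qed.

Lemma mxtrace_PL_upper (S : comPzRingType) (n : nat) (X U : 'M[S]_n) :
  hadamard (P_L S n) U = 0 -> \tr ((hadamard (P_L S n) X)^T *m U) = 0.
Proof.
move=> /matrixP U0; rewrite /mxtrace big1 // => i _; rewrite mxE big1 // => k _.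
by have := U0 k i; rewrite !mxE mulrAC => ->; rewrite mul0r.
Qed.

Lemma mxtrace_sub_tr_skew (S : comPzRingType) (n : nat) (X W : 'M[S]_n) :
  W^T = - W -> \tr ((X - X^T) *m W) = \tr (X *m W) *+ 2.
Proof.
move=> skW; rewrite mulmxBl raddfB /= -[\tr (X^T *m W)]mxtrace_tr trmx_mul.
by rewrite trmxK skW mulNmx raddfN /= mxtrace_mulC opprK mulr2n.
Qed.

Lemma sub_tr_PL (S : pzRingType) (n : nat) (Y : 'M[S]_n) :
  let L := hadamard (P_L S n) (Y - Y^T) in L - L^T = Y - Y^T.
Proof.
apply/matrixP => i j; rewrite !mxE; case: ltngtP => [_ | _ | /val_inj ->].
- by rewrite mul0r mul1r subr0.
- by rewrite mul0r mul1r sub0r opprB.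
- by rewrite !subrr.
Qed.

Lemma mxtrace_PL_skew (S : comPzRingType) (n : nat) (Y W : 'M[S]_n) :
    (forall x : S, x *+ 2 = 0 -> x = 0) -> W^T = - W ->
  \tr (hadamard (P_L S n) (Y - Y^T) *m W) = \tr (Y *m W).
Proof.
move=> reg2 skW; apply/eqP; rewrite -subr_eq0; apply/eqP/reg2.
by rewrite mulrnBl -!mxtrace_sub_tr_skew // sub_tr_PL subrr.
Qed.

Lemma qr_pullback_trace (S : comUnitRingType) (M N : nat)
    (reg2 : forall x : S, x *+ 2 = 0 -> x = 0)
    (A Q : 'M[S]_(M, N)) (R : 'M[S]_N) (Qbar : 'M[S]_(M, N)) (Rbar : 'M[S]_N)
    (dA dQ : 'M[S]_(M, N)) (dR : 'M[S]_N) :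
    R \in unitmx -> qr_system A Q R -> diff_qr_system Q R dA dQ dR ->
  \tr ((qr_pullback Q R Qbar Rbar)^T *m dA)
    = \tr (Qbar^T *m dQ) + \tr (Rbar^T *m dR).
Proof.
move=> uR [_ QQ upR] [-> skew updR].
pose W := Q^T *m dQ; pose U := dR *m invmx R.
have skW : W^T = - W.
  by apply/eqP; rewrite -addr_eq0 /W trmx_mul trmxK skew.
(* Since [U *m R = dR], the transpose [R^T *m U^T] is lower triangular, and [R^T] can be
   cancelled. *)
have upU : hadamard (P_L S N) U = 0.
  apply/hadamard_PL_eq0; apply: (@trig_mulmx_cancel _ _ R^T).
  - exact/hadamard_PL_eq0.
  - by rewrite unitmx_tr.
  - by rewrite -trmx_mul mulmxKV //; apply/hadamard_PL_eq0.
pose Y := R *m Rbar^T - Qbar^T *m Q.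
have YE : R *m Rbar^T - Rbar *m R^T + Q^T *m Qbar - Qbar^T *m Q = Y - Y^T.
  rewrite /Y raddfB /= !trmx_mul !trmxK opprB -!addrA; congr (_ + _).
  by rewrite addrC addrAC [RHS]addrC -!addrA.
pose L := hadamard (P_L S N) (Y - Y^T).
pose H := Qbar - Q *m Q^T *m Qbar.
have HQ : H^T *m Q = 0.
  rewrite /H raddfB /= !trmx_mul trmxK mulmxBl -!mulmxA QQ mulmx1.
  by rewrite subrr.
have HdQ : H^T *m dQ = Qbar^T *m dQ - Qbar^T *m Q *m W.
  by rewrite /H raddfB /= !trmx_mul trmxK mulmxBl !mulmxA.
have pullbackT : (qr_pullback Q R Qbar Rbar)^T
    = (Rbar^T + invmx R *m L^T) *m Q^T + invmx R *m H^T.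
  rewrite /qr_pullback YE -/L -/H raddfD /= !trmx_mul raddfD /= trmx_mul.
  by rewrite !trmxK.
have trLW : \tr (L^T *m W) = - \tr (L *m W).
  by rewrite -mxtrace_tr trmx_mul trmxK skW mulNmx raddfN /= mxtrace_mulC.
have -> : (qr_pullback Q R Qbar Rbar)^T *m (dQ *m R + Q *m dR)
    = (Rbar^T + invmx R *m L^T) *m (W *m R) + (Rbar^T + invmx R *m L^T) *m dR
      + invmx R *m (H^T *m dQ *m R).
  rewrite pullbackT mulmxDl !mulmxDr -!mulmxA (mulmxA _ Q dR) QQ mul1mx.
  by rewrite (mulmxA _ Q dR) HQ mul0mx mulmx0 addr0 !mulmxA.
rewrite !mxtraceD (mxtrace_mulC (invmx R)) mulmxK // HdQ raddfB /=.
have -> : \tr ((Rbar^T + invmx R *m L^T) *m (W *m R))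
    = \tr (R *m Rbar^T *m W) - \tr (L *m W).
  rewrite mulmxA mxtrace_mulC mulmxA mulmxDr mulKVmx //.
  by rewrite mulmxDl mxtraceD trLW.
have -> : \tr ((Rbar^T + invmx R *m L^T) *m dR) = \tr (Rbar^T *m dR).
  rewrite mulmxDl mxtraceD -mulmxA (mxtrace_mulC (invmx R)) -mulmxA.
  by rewrite mxtrace_PL_upper // addr0.
(* Replacing [L] by [Y] leaves [tr (Qbar^T Q W)], which cancels the correction coming from [HdQ]. *)
rewrite (mxtrace_PL_skew Y reg2 skW) /Y mulmxBl raddfB /= subKr.
by rewrite addrC addrA subrK.
Qed.

(** The truncated ring may have zero divisors, but it is a vector space over [K], where 2 is
    nonzero. *)
Lemma trunc_poly_mulr2n_eq0 (K : realType) (D : nat) (x : trunc_poly K D) :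
  x *+ 2 = 0 -> x = 0.
Proof.
move=> x2; have : (2%:R : K) *: x = 0 by rewrite scaler_nat.
by move/eqP; rewrite scaler_eq0 Num.Theory.pnatr_eq0 => /eqP.
Qed.

Theorem mainTheorem2 (K : realType) (M N D : nat)
    (hN : (1 <= N)%N) (hMN : (N <= M)%N) (hD : (1 <= D)%N)
    (A Q : 'M[trunc_poly K D]_(M, N)) (R : 'M[trunc_poly K D]_N)
    (hR : R \in unitmx) (hQR : qr_system A Q R)
    (Qbar : 'M[trunc_poly K D]_(M, N)) (Rbar : 'M[trunc_poly K D]_N) :
  (forall (dA dQ : 'M[trunc_poly K D]_(M, N)) (dR : 'M[trunc_poly K D]_N),
     diff_qr_system Q R dA dQ dR ->
     \tr ((qr_pullback Q R Qbar Rbar)^T *m dA)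
       = \tr (Qbar^T *m dQ) + \tr (Rbar^T *m dR))
  /\ (M = N -> (Qbar - Q *m Q^T *m Qbar) *m (invmx R)^T = 0).
Proof.
split=> [dA dQ dR | eqMN].
  exact: (qr_pullback_trace (@trunc_poly_mulr2n_eq0 K D) Qbar Rbar hR hQR).
subst N; case: hQR => _ QQ _.
(* For square [Q], the left inverse [Q^T] is also a right inverse. *)
by rewrite (mulmx1C QQ) mul1mx subrr mul0mx.
Qed.
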